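(* Assume that the measurements $(Y,\Phi)$ are such that $\Gamma=\mathcal{Z}(N)$ with $N_{22}<0$. Then for all $z\in\mathbb{R}^n$, $$\phi^{+}(z;\Gamma) = -N_{12}N_{22}^{-1}b(z) + \sqrt{(N|N_{22})\, b(z)^\top(-N_{22}^{-1})b(z)},$$ $$\phi^{-}(z;\Gamma) = -N_{12}N_{22}^{-1}b(z) - \sqrt{(N|N_{22})\, b(z)^\top(-N_{22}^{-1})b(z)}.$$
   Context: Conventions: for a symmetric matrix $P$, $P\geq 0$ (resp. $P>0$) means positive semidefinite (resp. definite); $P<0$ means $-P>0$. Let $\phi_1,\dots,\phi_k:\mathbb{R}^n\to\mathbb{R}$ be known basis functions, $b(z):=(\phi_1(z),\dots,\phi_k(z))^\top\in\mathbb{R}^k$, and for $\gamma\in\mathbb{R}^k$ let $\phi^\gamma(z):=\gamma^\top b(z)=\sum_{i=1}^k\gamma_i\phi_i(z)$. For a symmetric matrix $\Pi=\begin{bmatrix}\Pi_{11}&\Pi_{12}\\ \Pi_{21}&\Pi_{22}\end{bmatrix}\in\mathbb{R}^{(1+\ell)\times(1+\ell)}$ with $\Pi_{11}\in\mathbb{R}$, $\Pi_{22}\in\mathbb{R}^{\ell\times\ell}$, define $\mathcal{Z}(\Pi):=\{v\in\mathbb{R}^\ell \mid \begin{bmatrix}1\\ v\end{bmatrix}^\top\Pi\begin{bmatrix}1\\ v\end{bmatrix}\geq 0\}$; if $\Pi_{22}<0$, the Schur complement is $\Pi|\Pi_{22}:=\Pi_{11}-\Pi_{12}\Pi_{22}^{-1}\Pi_{21}$.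 Measurements: fix points $z_1,\dots,z_T\in\mathbb{R}^n$ and put $\Phi:=[\,b(z_1)\ \cdots\ b(z_T)\,]\in\mathbb{R}^{k\times T}$. There is an unknown true parameter $\hat\gamma\in\mathbb{R}^k$ and an unknown noise $W\in\mathbb{R}^{1\times T}$ such that the measured data satisfy $Y=\hat\gamma^\top\Phi+W\in\mathbb{R}^{1\times T}$. Standing noise assumption: $\Pi\in\mathbb{R}^{(1+T)\times(1+T)}$ is symmetric with $\Pi_{22}<0$ and $\Pi|\Pi_{22}\geq 0$, and $W^\top\in\mathcal{Z}(\Pi)$. The set of parameters consistent with the measurements is $\Gamma:=\{\gamma\in\mathbb{R}^k\mid Y=\gamma^\top\Phi+W' \text{ for some } W' \text{ with } (W')^\top\in\mathcal{Z}(\Pi)\}$. It equals $\mathcal{Z}(N)$, where $$N=\begin{bmatrix}N_{11}&N_{12}\\N_{21}&N_{22}\end{bmatrix}:=\begin{bmatrix}1&Y\\0&-\Phi\end{bmatrix}\Pi\begin{bmatrix}1&Y\\0&-\Phi\end{bmatrix}^\top\in\mathbb{R}^{(1+k)\times(1+k)},$$ partitioned with $N_{11}\in\mathbb{R}$, $N_{22}\in\mathbb{R}^{k\times k}$. In particular $\hat\gamma\in\Gamma$. Define $\phi^+(z;\Gamma):=\sup_{\gamma\in\Gamma}\phi^\gamma(z)$ and $\phi^-(z;\Gamma):=\inf_{\gamma\in\Gamma}\phi^\gamma(z)$. *)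

(* Defs.v *)
From HB Require Import structures.
From mathcomp Require Import all_boot all_order all_algebra.
From mathcomp Require Import boolp classical_sets reals ereal.

Set Implicit Arguments.
Unset Strict Implicit.
Unset Printing Implicit Defensive.

Import Order.TTheory GRing.Theory Num.Theory.
Local Open Scope classical_set_scope.
Local Open Scope ring_scope.

(* The unique entry of a 1 x 1 matrix; block expressions that are scalars on
   paper have type 'M_1 here. *)
Definition mx11 (R : realType) (A : 'M[R]_1) : R := A 0 0.

Definition posdefmx (R : realType) (m : nat) (P : 'M[R]_m) : Prop :=
  P^T = P /\ forall x : 'cV[R]_m, x != 0 -> 0 < mx11 (x^T *m P *m x).

Definition negdefmx (R : realType) (m : nat) (P : 'M[R]_m) : Prop :=
  posdefmx (- P).

(* The blocks of a (1 + l) x (1 + l) matrix are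
     P_11 = ulsubmx P, P_12 = ursubmx P, P_21 = dlsubmx P, P_22 = drsubmx P. *)
(* This is the set Z(P) of solutions of the quadratic inequality of P. *)
Definition QMIset (R : realType) (l : nat) (P : 'M[R]_(1 + l)) :
    set 'cV[R]_l :=
  [set v | 0 <= mx11 ((col_mx (1%:M : 'M[R]_1) v)^T *m P
                        *m col_mx (1%:M : 'M[R]_1) v)].

Definition schur (R : realType) (l : nat) (P : 'M[R]_(1 + l)) : R :=
  mx11 (ulsubmx P - ursubmx P *m invmx (drsubmx P) *m dlsubmx P).

Section BasisFunctions.
Variables (R : realType) (n k : nat) (phi : 'I_k -> 'cV[R]_n -> R).

Definition basis_vec (z : 'cV[R]_n) : 'cV[R]_k := \col_i phi i z.

Definition lincomb (g : 'cV[R]_k) (z : 'cV[R]_n) : R :=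
  mx11 (g^T *m basis_vec z).

Definition data_mx (T : nat) (zs : 'I_T -> 'cV[R]_n) : 'M[R]_(k, T) :=
  \matrix_(i < k, j < T) phi i (zs j).

(* The supremum and infimum are taken in the extended reals, so they carry
   their usual meaning even when G is empty or unbounded. *)
Definition phi_sup (G : set 'cV[R]_k) (z : 'cV[R]_n) : \bar R :=
  ereal_sup [set (lincomb g z)%:E | g in G].

Definition phi_inf (G : set 'cV[R]_k) (z : 'cV[R]_n) : \bar R :=
  ereal_inf [set (lincomb g z)%:E | g in G].

End BasisFunctions.

Section ConsistentParameters.
Variables (R : realType) (k T : nat).
Variables (P : 'M[R]_(1 + T)) (Phi : 'M[R]_(k, T)) (Y : 'rV[R]_T).

Definition consistent_set : set 'cV[R]_k :=
  [set g | exists2 W : 'rV[R]_T, QMIset P W^T & Y = g^T *m Phi + W].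

Definition data_block : 'M[R]_(1 + k, 1 + T) :=
  block_mx 1%:M Y 0 (- Phi).

Definition consistent_mx : 'M[R]_(1 + k) :=
  data_block *m P *m data_block^T.

(* The identity Gamma = Z(N) holds unconditionally, so assuming it loses no
   generality. *)
Lemma consistent_setE : consistent_set = QMIset consistent_mx.
Proof.
have key (g : 'cV[R]_k) :
    data_block^T *m col_mx (1%:M : 'M[R]_1) g
    = col_mx (1%:M : 'M[R]_1) (Y - g^T *m Phi)^T.
  rewrite tr_block_mx mul_block_col trmx1 mulmx1 trmx0 mul0mx addr0 mulmx1.
  by rewrite !linearB /= linearN /= trmx_mul trmxK mulNmx.
have quad (g : 'cV[R]_k) : QMIset consistent_mx g
    = QMIset P (Y - g^T *m Phi)^T.
  by rewrite /QMIset /= -key trmx_mul trmxK /consistent_mx !mulmxA.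
apply/seteqP; split=> g /=.
- by case=> W hW hY; rewrite quad hY [_ + W]addrC addrK.
- rewrite quad => hW; exists (Y - g^T *m Phi) => //.
  by rewrite addrC subrK.
Qed.

End ConsistentParameters.

(* Main.v *)
Require Import Defs.
From HB Require Import structures.
From mathcomp Require Import all_boot all_order all_algebra.
From mathcomp Require Import boolp classical_sets reals ereal.
From mathcomp Require Import lra.

Set Implicit Arguments.
Unset Strict Implicit.
Unset Printing Implicit Defensive.

Import Order.TTheory GRing.Theory Num.Theory.
Local Open Scope classical_set_scope.
Local Open Scope ring_scope.

(** When N22 is negative definite, completing the square turns the quadratic
    inequality of N into the equation of an ellipsoid: with the center
    c = - N22^-1 N21, a parameter c + x is consistent iff
    x^T (- N22) x <= N|N22 ([QMIset_ellipsoid]).  The value of the predictor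
    at z is the linear functional b(z)^T (c + x), so both formulas say how far
    a linear functional ranges over an ellipsoid.

    Write A = - N22, s = N|N22 and b = b(z).  The Cauchy-Schwarz inequality
    between the form A and its dual A^-1 ([dual_cauchy_schwarz]) gives
    |b^T x| <= sqrt (s * b^T A^-1 b) on the ellipsoid, and the point of the
    ellipsoid in the direction A^-1 b attains this bound
    ([ellipsoid_linear_attained]).  The ellipsoid is symmetric about
    its center, so one maximizer x serves both extrema: c + x for the supremum
    and c - x for the infimum.

    The true parameter is consistent with the data, so the ellipsoid is not
    empty, which forces N|N22 to be nonnegative ([schur_ge0]); N is symmetric
    because it is a congruence transform of the symmetric matrix Pi. *)

(** * Positive definite forms and their duals *)

Lemma mx11D (R : realType) (A B : 'M[R]_1) : mx11 (A + B) = mx11 A + mx11 B.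
Proof. by rewrite /mx11 mxE. Qed.

Lemma mx11N (R : realType) (A : 'M[R]_1) : mx11 (- A) = - mx11 A.
Proof. by rewrite /mx11 mxE. Qed.

Lemma mx11Z (R : realType) a (A : 'M[R]_1) : mx11 (a *: A) = a * mx11 A.
Proof. by rewrite /mx11 mxE. Qed.

Lemma mx11_tr (R : realType) (A : 'M[R]_1) : mx11 A^T = mx11 A.
Proof. by rewrite /mx11 mxE. Qed.

Lemma quad_formZ (R : realType) m (A : 'M[R]_m) a (x : 'cV[R]_m) :
  mx11 ((a *: x)^T *m A *m (a *: x)) = a ^+ 2 * mx11 (x^T *m A *m x).
Proof.
have -> : (a *: x)^T = a *: x^T by rewrite linearZ.
by rewrite -!(scalemxAl, scalemxAr) !mx11Z mulrA.
Qed.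

Lemma posdefmx_ge0 (R : realType) m (A : 'M[R]_m) (x : 'cV[R]_m) :
  posdefmx A -> 0 <= mx11 (x^T *m A *m x).
Proof.
move=> [_ Apos]; have [->|x0] := eqVneq x 0; last exact/ltW/Apos.
by rewrite mulmx0 /mx11 mxE.
Qed.

Lemma posdefmx_unit (R : realType) m (A : 'M[R]_m) :
  posdefmx A -> A \in unitmx.
Proof.
move=> [_ Apos]; rewrite -row_free_unit; apply: inj_row_free => v vA0.
apply: contra_eq vA0 => v0; apply/negP => /eqP vA0.
have := Apos v^T; rewrite trmx_eq0 trmxK vA0 mul0mx /mx11 mxE ltxx.
by move=> /(_ v0).
Qed.

Lemma invmxN (R : realType) m (A : 'M[R]_m) :
  - A \in unitmx -> invmx (- A) = - invmx A.
Proof. by rewrite -!scaleN1r => /invmxZ ->; rewrite invrN1. Qed.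

(** The substitution y = A^-1 b identifies the dual form at b with the form
    of A at y, so positivity of the dual follows from that of A. *)
Lemma dual_form_inv (R : realType) m (A : 'M[R]_m) (b : 'cV[R]_m) :
  posdefmx A ->
  mx11 ((invmx A *m b)^T *m A *m (invmx A *m b)) = mx11 (b^T *m invmx A *m b).
Proof.
move=> Apos; have [Asym _] := Apos; have Au := posdefmx_unit Apos.
rewrite trmx_mul trmx_inv Asym -!mulmxA (mulmxA A) mulmxV // mul1mx.
by rewrite !mulmxA.
Qed.

Lemma dual_form_ge0 (R : realType) m (A : 'M[R]_m) (b : 'cV[R]_m) :
  posdefmx A -> 0 <= mx11 (b^T *m invmx A *m b).
Proof. by move=> Apos; rewrite -dual_form_inv //; apply: posdefmx_ge0. Qed.

Lemma dual_form_eq0 (R : realType) m (A : 'M[R]_m) (b : 'cV[R]_m) :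
  posdefmx A -> mx11 (b^T *m invmx A *m b) = 0 -> b = 0.
Proof.
move=> Apos; rewrite -dual_form_inv // => q0.
have [y0|/(proj2 Apos)] := eqVneq (invmx A *m b) 0; last by rewrite q0 ltxx.
by rewrite -(mulKVmx (posdefmx_unit Apos) b) y0 mulmx0.
Qed.

(** With y = A^-1 b, beta = b^T A^-1 b and t = b^T x, expanding the form of A
    at beta x - t y gives beta * (beta * (x^T A x) - t^2), which is
    nonnegative; if beta = 0 then b = 0 and both sides vanish. *)
Lemma dual_cauchy_schwarz (R : realType) m (A : 'M[R]_m) (b x : 'cV[R]_m) :
  posdefmx A ->
  mx11 (b^T *m x) ^+ 2
    <= mx11 (x^T *m A *m x) * mx11 (b^T *m invmx A *m b).
Proof.
move=> Apos; have [Asym _] := Apos; have Au := posdefmx_unit Apos.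
have := dual_form_ge0 b Apos; rewrite le_eqVlt => /predU1P[/esym b0|].
  rewrite b0 mulr0 (dual_form_eq0 Apos b0) trmx0 mul0mx.
  by rewrite /mx11 mxE expr0n.
have yAx : mx11 ((invmx A *m b)^T *m A *m x) = mx11 (b^T *m x).
  by rewrite trmx_mul trmx_inv Asym mulmxKV.
have xAy : mx11 (x^T *m A *m (invmx A *m b)) = mx11 (b^T *m x).
  by rewrite -mx11_tr !trmx_mul trmxK trmx_inv Asym mulmxA mulmxKV.
have yAy := dual_form_inv b Apos.
set y := invmx A *m b in yAx xAy yAy.
set be := mx11 (b^T *m invmx A *m b) in yAy *.
set t := mx11 (b^T *m x) in yAx xAy *; move=> be0.
have := posdefmx_ge0 (be *: x + (- t) *: y) Apos.
have -> : (be *: x + (- t) *: y)^T = be *: x^T + (- t) *: y^T.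
  by rewrite linearD /= !linearZ.
rewrite !(mulmxDl, mulmxDr) -!(scalemxAl, scalemxAr).
rewrite !(mx11D, mx11Z) yAx xAy yAy => h.
by rewrite -subr_ge0 -(pmulr_rge0 _ be0); apply: le_trans h _; lra.
Qed.

(** * Linear functionals on an ellipsoid *)

Lemma ellipsoid_linear_bound (R : realType) m (A : 'M[R]_m) (s : R)
    (b x : 'cV[R]_m) :
  posdefmx A -> mx11 (x^T *m A *m x) <= s ->
  `|mx11 (b^T *m x)| <= Num.sqrt (s * mx11 (b^T *m invmx A *m b)).
Proof.
move=> Apos xs; rewrite -sqrtr_sqr ler_wsqrtr //.
apply: le_trans (dual_cauchy_schwarz b x Apos) _.
by rewrite ler_wpM2r // dual_form_ge0.
Qed.

(** The maximizer lies in the direction A^-1 b, the equality case of the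
    Cauchy-Schwarz inequality. *)
Lemma ellipsoid_linear_attained (R : realType) m (A : 'M[R]_m) (s : R)
    (b : 'cV[R]_m) :
  posdefmx A -> 0 <= s ->
  exists2 x : 'cV[R]_m, mx11 (x^T *m A *m x) <= s &
    mx11 (b^T *m x) = Num.sqrt (s * mx11 (b^T *m invmx A *m b)).
Proof.
move=> Apos s0; set be := mx11 _.
have be_ge0 : 0 <= be by apply: dual_form_ge0.
(* The scalar puts the point on the boundary; if be = 0 then the convention
   s / 0 = 0 makes it the center. *)
exists (Num.sqrt (s / be) *: (invmx A *m b)).
  rewrite quad_formZ dual_form_inv // -/be sqr_sqrtr ?divr_ge0 //.
  have [->|be0] := eqVneq be 0; first by rewrite mulr0.
  by rewrite divfK.
rewrite -scalemxAr mx11Z mulmxA -/be.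
have [->|be0] := eqVneq be 0; first by rewrite !mulr0 sqrtr0.
rewrite -[X in _ * X](ger0_norm be_ge0) -sqrtr_sqr -sqrtrM ?divr_ge0 //.
by rewrite expr2 mulrA divfK.
Qed.

(** * The quadratic matrix inequality as an ellipsoid *)

(** The shift - P22^-1 P21 is the stationary point of the quadratic function
    of v, so the linear terms cancel and the constant left over is the Schur
    complement. *)
Lemma QMI_complete_square (R : realType) l (P : 'M[R]_(1 + l)) (v : 'cV[R]_l) :
  P^T = P -> negdefmx (drsubmx P) ->
  let w := v + invmx (drsubmx P) *m dlsubmx P in
  mx11 ((col_mx (1%:M : 'M[R]_1) v)^T *m P *m col_mx (1%:M : 'M[R]_1) v)
  = schur P - mx11 (w^T *m (- drsubmx P) *m w).
Proof.
move=> Psym Pneg /=.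
have D_unit : drsubmx P \in unitmx.
  by rewrite -[drsubmx P]opprK -scaleN1r unitmxZ ?unitrN1 // posdefmx_unit.
have Dsym : (drsubmx P)^T = drsubmx P by rewrite trmx_drsub Psym.
have Bsym : (dlsubmx P)^T = ursubmx P by rewrite trmx_dlsub Psym.
rewrite /schur -{1}(submxK P).
move: Dsym Bsym D_unit.
move: (ulsubmx P) (ursubmx P) (dlsubmx P) (drsubmx P) => a B C D Dsym Bsym Du.
rewrite tr_col_mx trmx1 mul_row_block mul_row_col !mul1mx mulmx1.
have -> : (v + invmx D *m C)^T = v^T + B *m invmx D.
  by rewrite linearD /= trmx_mul trmx_inv Dsym Bsym.
rewrite !(mulmxDl, mulmxDr, mulmxN, mulNmx) mulmxKV // !mulmxA.
rewrite mulmxK // !(mx11D, mx11N).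
lra.
Qed.

(** * Extrema of the predictor *)

Section QMIExtrema.
Variables (R : realType) (n k : nat) (phi : 'I_k -> 'cV[R]_n -> R).
Variable P : 'M[R]_(1 + k).
Hypotheses (Psym : P^T = P) (Pneg : negdefmx (drsubmx P)).
Hypothesis P_feasible : QMIset P !=set0.

Let center : 'cV[R]_k := - (invmx (drsubmx P) *m dlsubmx P).

Lemma QMIset_ellipsoid (x : 'cV[R]_k) :
  QMIset P (center + x) <-> mx11 (x^T *m (- drsubmx P) *m x) <= schur P.
Proof.
rewrite /QMIset /= QMI_complete_square // [center + x]addrC subrK subr_ge0.
by [].
Qed.

(** Any feasible point, written center + x, has
    0 <= x^T (- P22) x <= P|P22. *)
Lemma schur_ge0 : 0 <= schur P.
Proof.
case: P_feasible => v; rewrite -[v](subrKC center) => /QMIset_ellipsoid.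
by apply: le_trans; apply: posdefmx_ge0.
Qed.

Lemma lincomb_center (x : 'cV[R]_k) (z : 'cV[R]_n) :
  lincomb phi (center + x) z
  = mx11 (- ursubmx P *m invmx (drsubmx P) *m basis_vec phi z)
    + mx11 ((basis_vec phi z)^T *m x).
Proof.
rewrite /lincomb linearD mulmxDl mx11D; congr (_ + _).
  rewrite linearN /= trmx_mul trmx_inv trmx_drsub trmx_dlsub Psym.
  by rewrite !mulNmx.
by rewrite -mx11_tr trmx_mul trmxK.
Qed.

Lemma QMI_lincomb_extrema (z : 'cV[R]_n) :
  let b := basis_vec phi z in
  let m := mx11 (- ursubmx P *m invmx (drsubmx P) *m b) in
  let r := Num.sqrt (schur P * mx11 (b^T *m (- invmx (drsubmx P)) *m b)) in
  phi_sup phi (QMIset P) z = (m + r)%:E /\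
  phi_inf phi (QMIset P) z = (m - r)%:E.
Proof.
move=> b m r.
have rE : r = Num.sqrt (schur P * mx11 (b^T *m invmx (- drsubmx P) *m b)).
  by rewrite /r invmxN // posdefmx_unit.
have bound v : QMIset P v -> m - r <= lincomb phi v z <= m + r.
  rewrite -[v](subrKC center) => /QMIset_ellipsoid vP.
  rewrite lincomb_center !lerD2l -ler_norml rE.
  exact: ellipsoid_linear_bound.
have [x xP bx] := ellipsoid_linear_attained b Pneg schur_ge0.
split; apply/eqP; rewrite eq_le; apply/andP; split.
- by apply: ge_ereal_sup => _ [v /bound/andP[_ vr] <-]; rewrite lee_fin.
- apply: ereal_sup_ubound; exists (center + x); first exact/QMIset_ellipsoid.
  by rewrite lincomb_center bx -rE.
- apply: ereal_inf_lbound; exists (center - x).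
    apply/QMIset_ellipsoid.
    by rewrite -scaleN1r quad_formZ sqrrN expr1n mul1r.
  by rewrite lincomb_center mulmxN mx11N bx -rE.
- by apply: le_ereal_inf_tmp => _ [v /bound/andP[vr _] <-]; rewrite lee_fin.
Qed.

End QMIExtrema.

Theorem mainTheorem1 (R : realType) (n k T : nat)
    (phi : 'I_k -> 'cV[R]_n -> R) (zs : 'I_T -> 'cV[R]_n)
    (Pi : 'M[R]_(1 + T)) (Y W : 'rV[R]_T) (gammahat : 'cV[R]_k)
    (Pi_sym : Pi^T = Pi)
    (Pi22_neg : negdefmx (drsubmx Pi))
    (Pi_schur : 0 <= schur Pi)
    (W_noise : QMIset Pi W^T)
    (Y_data : Y = gammahat^T *m data_mx phi zs + W) :
  let Gamma := consistent_set Pi (data_mx phi zs) Y in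
  let N := consistent_mx Pi (data_mx phi zs) Y in
  let N12 := ursubmx N in
  let N22 := drsubmx N in
  Gamma = QMIset N -> negdefmx N22 ->
  forall z : 'cV[R]_n,
    let b := basis_vec phi z in
    phi_sup phi Gamma z =
      (mx11 (- N12 *m invmx N22 *m b)
       + Num.sqrt (schur N * mx11 (b^T *m (- invmx N22) *m b)))%:E
    /\
    phi_inf phi Gamma z =
      (mx11 (- N12 *m invmx N22 *m b)
       - Num.sqrt (schur N * mx11 (b^T *m (- invmx N22) *m b)))%:E.
Proof.
move=> Gamma N N12 N22 GammaE N22_neg z b; rewrite GammaE.
apply: QMI_lincomb_extrema => //.
  by rewrite /N /consistent_mx !trmx_mul trmxK Pi_sym mulmxA.
by exists gammahat; rewrite -GammaE; exists W.
Qed.
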